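(* Let $\mathbf{k}$ be a commutative unital ring, $\lambda\in\mathbf{k}$, and let $(A,m,\Delta)$ be an infinitesimal bialgebra of weight $\lambda$ over $\mathbf{k}$. Then $(A,\rhd)$ is a (left) pre-Lie algebra, where $$\rhd:A\otimes A\to A,\quad a\otimes b\mapsto a\rhd b:=\sum_{(b)}b_{(1)}\,a\,b_{(2)}.$$
   Context: An infinitesimal bialgebra of weight $\lambda$ is a triple $(A,m,\Delta)$ with $(A,m)$ an associative algebra (possibly without unit) and $(A,\Delta)$ a coassociative coalgebra (possibly without counit) such that $\Delta(ab)=a\cdot\Delta(b)+\Delta(a)\cdot b+\lambda(a\otimes b)$ for all $a,b\in A$, where $a\cdot(b\otimes c)=ab\otimes c$ and $(b\otimes c)\cdot a=b\otimes ca$. Sweedler notation: $\Delta(b)=\sum_{(b)}b_{(1)}\otimes b_{(2)}$. A (left) pre-Lie algebra is a $\mathbf{k}$-module $A$ with a bilinear operation $\rhd$ satisfying $(a\rhd b)\rhd c-a\rhd(b\rhd c)=(b\rhd a)\rhd c-b\rhd(a\rhd c)$ for all $a,b,c\in A$. *)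

(* Defs.v *)
From HB Require Import structures.
From mathcomp Require Import all_boot all_algebra boolp.

Set Implicit Arguments.
Unset Strict Implicit.
Unset Printing Implicit Defensive.

Import GRing.Theory.
Local Open Scope ring_scope.
Local Open Scope quotient_scope.

(* [sesquilinear.v] only provides bilinear maps over nontrivial rings; here the
   base ring may be any commutative unital ring. *)
Definition bilinear_map (k : comPzRingType) (M N P : lmodType k)
    (f : M -> N -> P) : Prop :=
  (forall x, linear (f x)) /\ (forall y, linear (f^~ y)).

(* The list [:: (x1, y1); ...; (xn, yn)] stands for the formal sum of the
   symbols xi (x) yi.  No coefficients are needed, since a scalar can be moved
   into xi; the relations below make the quotient an abelian group (with
   opposite (- xi) (x) yi) and then a k-module. *)
Inductive tensor_eq (k : comPzRingType) (M N : lmodType k) :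
    seq (M * N) -> seq (M * N) -> Prop :=
| tensor_eq_refl s : tensor_eq s s
| tensor_eq_sym s t : tensor_eq s t -> tensor_eq t s
| tensor_eq_trans s t u : tensor_eq s t -> tensor_eq t u -> tensor_eq s u
| tensor_eq_cat s s' t t' :
    tensor_eq s s' -> tensor_eq t t' -> tensor_eq (s ++ t) (s' ++ t')
| tensor_eqC s t : tensor_eq (s ++ t) (t ++ s)
| tensor_eq0 y : tensor_eq [:: (0, y)] [::]
| tensor_eqDl x x' y : tensor_eq [:: (x + x', y)] [:: (x, y); (x', y)]
| tensor_eqDr x y y' : tensor_eq [:: (x, y + y')] [:: (x, y); (x, y')]
| tensor_eqZ a x y : tensor_eq [:: (a *: x, y)] [:: (x, a *: y)].

Section TensorProduct.
Variables (k : comPzRingType) (M N : lmodType k).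
Implicit Types (s t : seq (M * N)).

Definition tensor_rel s t : bool := `[< tensor_eq s t >].

Lemma tensor_rel_refl : reflexive tensor_rel.
Proof. by move=> s; apply/asboolP; apply: tensor_eq_refl. Qed.

Lemma tensor_rel_sym : symmetric tensor_rel.
Proof. by move=> s t; apply/asboolP/asboolP; apply: tensor_eq_sym. Qed.

Lemma tensor_rel_trans : transitive tensor_rel.
Proof.
move=> t s u /asboolP st /asboolP tu.
by apply/asboolP; apply: tensor_eq_trans st tu.
Qed.

Canonical tensor_equiv :=
  EquivRel tensor_rel tensor_rel_refl tensor_rel_sym tensor_rel_trans.

Definition tensor := {eq_quot tensor_equiv}.
HB.instance Definition _ := Choice.on tensor.
HB.instance Definition _ := EqQuotient.on tensor.

Definition tensor_of_seq s : tensor := \pi_tensor s.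
Definition tensor_repr (u : tensor) : seq (M * N) := repr u.

Lemma tensorK u : tensor_of_seq (tensor_repr u) = u.
Proof. exact: reprK. Qed.

Lemma tensorW (P : tensor -> Prop) :
  (forall s, P (tensor_of_seq s)) -> forall u, P u.
Proof. by move=> Ps u; rewrite -[u]tensorK. Qed.

Lemma tensorP s t : tensor_eq s t <-> tensor_of_seq s = tensor_of_seq t.
Proof.
split=> [st|/eqquotP/asboolP //].
by apply/eqquotP/asboolP.
Qed.

Lemma tensor_reprK s : tensor_eq (tensor_repr (tensor_of_seq s)) s.
Proof. by apply/tensorP; rewrite tensorK. Qed.

Definition tensor_scale_seq (a : k) s := [seq (a *: p.1, p.2) | p <- s].

Lemma tensor_scale_seq_eq a s t :
  tensor_eq s t -> tensor_eq (tensor_scale_seq a s) (tensor_scale_seq a t).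
Proof.
elim=> {s t}.
- by move=> s; apply: tensor_eq_refl.
- by move=> s t _; apply: tensor_eq_sym.
- by move=> s t u _ h1 _; apply: tensor_eq_trans.
- by move=> s s' t t' _ h1 _ h2; rewrite /tensor_scale_seq !map_cat;
     apply: tensor_eq_cat.
- by move=> s t; rewrite /tensor_scale_seq !map_cat; apply: tensor_eqC.
- by move=> y /=; rewrite scaler0; apply: tensor_eq0.
- by move=> x x' y /=; rewrite scalerDr; apply: tensor_eqDl.
- by move=> x y y' /=; apply: tensor_eqDr.
- by move=> b x y /=; rewrite scalerA mulrC -scalerA; apply: tensor_eqZ.
Qed.

Definition tensor_zero : tensor := tensor_of_seq [::].
Definition tensor_add (u v : tensor) : tensor :=
  tensor_of_seq (tensor_repr u ++ tensor_repr v).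
Definition tensor_scale (a : k) (u : tensor) : tensor :=
  tensor_of_seq (tensor_scale_seq a (tensor_repr u)).
Definition tensor_opp (u : tensor) : tensor := tensor_scale (- 1) u.

Lemma tensor_addE s t :
  tensor_add (tensor_of_seq s) (tensor_of_seq t) = tensor_of_seq (s ++ t).
Proof. by apply/tensorP/tensor_eq_cat; apply: tensor_reprK. Qed.

Lemma tensor_scaleE a s :
  tensor_scale a (tensor_of_seq s) = tensor_of_seq (tensor_scale_seq a s).
Proof. by apply/tensorP/tensor_scale_seq_eq; apply: tensor_reprK. Qed.

Lemma tensor_addA : associative tensor_add.
Proof.
elim/tensorW=> s; elim/tensorW=> t; elim/tensorW=> u.
by rewrite !tensor_addE catA.
Qed.

Lemma tensor_addC : commutative tensor_add.
Proof.
elim/tensorW=> s; elim/tensorW=> t.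
by rewrite !tensor_addE; apply/tensorP/tensor_eqC.
Qed.

Lemma tensor_add0 : left_id tensor_zero tensor_add.
Proof. by elim/tensorW=> s; rewrite tensor_addE. Qed.

Lemma tensor_scaleDl u :
  {morph tensor_scale^~ u : a b / a + b >-> tensor_add a b}.
Proof.
move=> a b; elim/tensorW: u => s; rewrite !tensor_scaleE tensor_addE.
apply/tensorP; elim: s => [|[x y] s ih] /=; first exact: tensor_eq_refl.
rewrite scalerDl -cat1s.
apply: (tensor_eq_trans (tensor_eq_cat (tensor_eqDl _ _ _) ih)).
rewrite -[X in tensor_eq _ X]cat1s /= -[_ :: (_ :: _)]cat1s.
apply: (@tensor_eq_cat _ _ _ [:: _] [:: _]); first exact: tensor_eq_refl.
rewrite -cat1s catA -[X in tensor_eq _ (_ ++ X)]cat1s catA.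
by apply: tensor_eq_cat; [exact: tensor_eqC|exact: tensor_eq_refl].
Qed.

Lemma tensor_scale0 u : tensor_scale 0 u = tensor_zero.
Proof.
elim/tensorW: u => s; rewrite tensor_scaleE; apply/tensorP.
elim: s => [|[x y] s ih] /=; first exact: tensor_eq_refl.
rewrite scale0r.
exact: (@tensor_eq_cat _ _ _ [:: (0, y)] [::] _ [::] (tensor_eq0 _ _) ih).
Qed.

Lemma tensor_scale1 : left_id 1 tensor_scale.
Proof.
elim/tensorW=> s; rewrite tensor_scaleE; congr (tensor_of_seq _).
by rewrite -[RHS]map_id; apply: eq_map => -[x y] /=; rewrite scale1r.
Qed.

Lemma tensor_addN : left_inverse tensor_zero tensor_opp tensor_add.
Proof.
move=> u; rewrite -[X in tensor_add _ X]tensor_scale1.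
by rewrite -tensor_scaleDl addNr tensor_scale0.
Qed.

HB.instance Definition _ := GRing.isZmodule.Build tensor
  tensor_addA tensor_addC tensor_add0 tensor_addN.

Lemma tensor_scaleA a b u :
  tensor_scale a (tensor_scale b u) = tensor_scale (a * b) u.
Proof.
elim/tensorW: u => s; rewrite !tensor_scaleE; congr (tensor_of_seq _).
by rewrite /tensor_scale_seq -map_comp; apply: eq_map => p /=; rewrite scalerA.
Qed.

Lemma tensor_scaleDr : right_distributive tensor_scale +%R.
Proof.
move=> a; elim/tensorW=> s; elim/tensorW=> t.
rewrite [LHS](congr1 _ (tensor_addE _ _)) !tensor_scaleE.
by rewrite [RHS]tensor_addE /tensor_scale_seq map_cat.
Qed.

HB.instance Definition _ := GRing.Zmodule_isLmodule.Build k tensor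
  tensor_scaleA tensor_scale1 tensor_scaleDr tensor_scaleDl.

Definition tens (x : M) (y : N) : tensor := tensor_of_seq [:: (x, y)].

Lemma tens_bilinear : bilinear_map tens.
Proof.
split=> [x a y y'|y a x x'].
- transitivity (tens x (a *: y) + tens x y').
    by rewrite [RHS]tensor_addE; apply/tensorP/tensor_eqDr.
  congr (_ + _); rewrite [RHS]tensor_scaleE.
  by apply/tensorP/tensor_eq_sym/tensor_eqZ.
- transitivity (tens (a *: x) y + tens x' y).
    by rewrite [RHS]tensor_addE; apply/tensorP/tensor_eqDl.
  by congr (_ + _); rewrite [RHS]tensor_scaleE.
Qed.

Lemma tensor_sumE (u : tensor) : u = \sum_(p <- tensor_repr u) tens p.1 p.2.
Proof.
rewrite -[LHS]tensorK; elim: (tensor_repr u) => [|[x y] s ih]; first by rewrite big_nil.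
by rewrite big_cons -ih [RHS]tensor_addE.
Qed.

(* The linear map on [tensor] induced by f.  The value does not depend on the
   chosen representative when f is bilinear, see [tensor_liftE]. *)
Definition tensor_lift (P : lmodType k) (f : M -> N -> P) (u : tensor) : P :=
  \sum_(p <- tensor_repr u) f p.1 p.2.

Section Lift.
Variables (P : lmodType k) (f : M -> N -> P).
Hypothesis f_bilin : bilinear_map f.

Lemma tensor_lift_eq s t : tensor_eq s t ->
  \sum_(p <- s) f p.1 p.2 = \sum_(p <- t) f p.1 p.2.
Proof.
have [fr fl] := f_bilin.
have f0 y : f 0 y = 0.
  by have := fl y (-1) 0 0; rewrite scaler0 addr0 scaleN1r addNr.
elim=> {s t} //.
- by move=> s t u _ -> _ ->.
- by move=> s s' t t' _ h1 _ h2; rewrite !big_cat /= h1 h2.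
- by move=> s t; rewrite !big_cat /= addrC.
- by move=> y; rewrite big_seq1 big_nil f0.
- move=> x x' y; rewrite !big_cons !big_nil !addr0 /=.
  by have := fl y 1 x x'; rewrite !scale1r.
- move=> x y y'; rewrite !big_cons !big_nil !addr0 /=.
  by have := fr x 1 y y'; rewrite !scale1r.
- move=> a x y; rewrite !big_seq1 /=.
  have fr0 : f x 0 = 0.
    by have := fr x (-1) 0 0; rewrite scaler0 addr0 scaleN1r addNr.
  have := fl y a x 0; rewrite !addr0 f0 addr0 => ->.
  by have := fr x a y 0; rewrite !addr0 fr0 addr0.
Qed.

Lemma tensor_lift_pi s :
  tensor_lift f (tensor_of_seq s) = \sum_(p <- s) f p.1 p.2.
Proof. by apply: tensor_lift_eq; apply: tensor_reprK. Qed.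

Lemma tensor_liftE x y : tensor_lift f (tens x y) = f x y.
Proof. by rewrite [LHS](tensor_lift_pi [:: (x, y)]) big_seq1. Qed.

Lemma tensor_lift_linear : linear (tensor_lift f).
Proof.
have [_ fl] := f_bilin.
have f0 y : f 0 y = 0.
  by have := fl y (-1) 0 0; rewrite scaler0 addr0 scaleN1r addNr.
move=> a; elim/tensorW=> s; elim/tensorW=> t.
have -> : a *: tensor_of_seq s + tensor_of_seq t =
          tensor_of_seq (tensor_scale_seq a s ++ t).
  by rewrite -tensor_addE -tensor_scaleE.
rewrite !tensor_lift_pi big_cat big_map /= scaler_sumr; congr (_ + _).
apply: eq_bigr => p _.
by have := fl p.2 a p.1 0; rewrite !addr0 f0 addr0.
Qed.

(* With [tensor_liftE] and [tensor_lift_linear], this is the universal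
   property of the tensor product. *)
Lemma tensor_lift_unique (g : tensor -> P) :
  linear g -> (forall x y, g (tens x y) = f x y) -> g =1 tensor_lift f.
Proof.
move=> glin gE u.
pose G : {linear tensor -> P} :=
  HB.pack g (GRing.isLinear.Build k tensor P _ g glin).
rewrite [in LHS](tensor_sumE u) -[g]/(G : _ -> _) linear_sum.
by apply: eq_bigr => p _; apply: gE.
Qed.

End Lift.
End TensorProduct.

Notation "x ⊗ y" := (tens x y) (at level 40, left associativity) : ring_scope.

Section TensorMaps.
Variable k : comPzRingType.

Definition tensor_map (M M' N N' : lmodType k) (f : M -> M') (g : N -> N')
    (u : tensor M N) : tensor M' N' :=
  tensor_lift (fun x y => f x ⊗ g y) u.

Definition tensor_assoc (M N P : lmodType k) (u : tensor (tensor M N) P) :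
    tensor M (tensor N P) :=
  tensor_lift (fun v z => tensor_lift (fun x y => x ⊗ (y ⊗ z)) v) u.

Lemma tensor_map_bilinear (M M' N N' : lmodType k) (f : M -> M') (g : N -> N') :
  linear f -> linear g -> bilinear_map (fun x y => f x ⊗ g y).
Proof.
move=> flin glin; have [tr tl] := tens_bilinear M' N'.
by split=> [x a y y'|y a x x'] /=; rewrite ?flin ?glin ?tr ?tl.
Qed.

Lemma tensor_mapE (M M' N N' : lmodType k) (f : M -> M') (g : N -> N') x y :
  linear f -> linear g -> tensor_map f g (x ⊗ y) = f x ⊗ g y.
Proof. by move=> fl gl; apply/tensor_liftE/tensor_map_bilinear. Qed.

Lemma tensor_assoc_bilinear_in (M N P : lmodType k) (z : P) :
  bilinear_map (fun (x : M) (y : N) => x ⊗ (y ⊗ z)).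
Proof.
have [_ nl] := tens_bilinear N P; have [mr ml] := tens_bilinear M (tensor N P).
by split=> [x a y y'|y a x x'] /=; rewrite ?nl ?mr ?ml.
Qed.

Lemma tensor_assoc_bilinear (M N P : lmodType k) :
  bilinear_map (fun (v : tensor M N) (z : P) =>
    tensor_lift (fun x y => x ⊗ (y ⊗ z)) v).
Proof.
have [nr _] := tens_bilinear N P; have [mr _] := tens_bilinear M (tensor N P).
split=> [v a z z'|z].
  rewrite /tensor_lift scaler_sumr -big_split; apply: eq_bigr => p _ /=.
  by rewrite nr mr.
exact: tensor_lift_linear (tensor_assoc_bilinear_in _ _ z).
Qed.

Lemma tensor_assocE (M N P : lmodType k) (x : M) (y : N) (z : P) :
  tensor_assoc ((x ⊗ y) ⊗ z) = x ⊗ (y ⊗ z).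
Proof.
rewrite /tensor_assoc (tensor_liftE (tensor_assoc_bilinear M N P)).
exact: tensor_liftE (tensor_assoc_bilinear_in _ _ z) x y.
Qed.

End TensorMaps.

Section InfinitesimalBialgebra.
Variables (k : comPzRingType) (A : lmodType k).
Implicit Types (m : A -> A -> A) (Delta : A -> tensor A A).

Definition coassociative Delta : Prop := forall a,
  tensor_assoc (tensor_map Delta id (Delta a)) = tensor_map id Delta (Delta a).

(* a . (b ⊗ c) = ab ⊗ c *)
Definition tensor_lact m (a : A) (u : tensor A A) : tensor A A :=
  tensor_lift (fun b c => m a b ⊗ c) u.

(* (b ⊗ c) . a = b ⊗ ca *)
Definition tensor_ract m (u : tensor A A) (a : A) : tensor A A :=
  tensor_lift (fun b c => b ⊗ m c a) u.

Lemma tensor_lactE m a b c :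
  bilinear_map m -> tensor_lact m a (b ⊗ c) = m a b ⊗ c.
Proof. by case=> mr _; apply: (@tensor_mapE _ _ _ _ _ (m a) id). Qed.

Lemma tensor_ractE m a b c :
  bilinear_map m -> tensor_ract m (b ⊗ c) a = b ⊗ m c a.
Proof. by case=> _ ml; apply: (@tensor_mapE _ _ _ _ _ id (m^~ a)). Qed.

Record infinitesimal_bialgebra (lambda : k) m Delta : Prop := {
  infbialg_mul_bilinear : bilinear_map m;
  infbialg_mulA : associative m;
  infbialg_comul_linear : linear Delta;
  infbialg_coassoc : coassociative Delta;
  infbialg_comulM : forall a b, Delta (m a b) =
    tensor_lact m a (Delta b) + tensor_ract m (Delta a) b + lambda *: (a ⊗ b)
}.

Record left_pre_lie (rhd : A -> A -> A) : Prop := {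
  pre_lie_bilinear : bilinear_map rhd;
  pre_lie_identity : forall a b c,
    rhd (rhd a b) c - rhd a (rhd b c) = rhd (rhd b a) c - rhd b (rhd a c)
}.

(* \sum_(b) b_(1) a b_(2) *)
Definition infbialg_rhd m Delta (a b : A) : A :=
  tensor_lift (fun b1 b2 => m (m b1 a) b2) (Delta b).

End InfinitesimalBialgebra.

(* Main.v *)
Require Import Defs.
From HB Require Import structures.
From mathcomp Require Import all_boot all_algebra.

Set Implicit Arguments.
Unset Strict Implicit.
Unset Printing Implicit Defensive.

Import GRing.Theory.
Local Open Scope ring_scope.

(** For fixed [a], the map [a ▷ _] is almost a derivation: applying
    [x ⊗ y |-> x a y] to the compatibility of [Delta] with the product gives
    [a ▷ (xy) = x (a ▷ y) + (a ▷ x) y + lambda x a y] ([infbialg_rhdM]).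
    Expanding [a ▷ (b ▷ c) = \sum_(c) a ▷ (c1 b c2)] by this rule yields five
    sums.  The one in which [a] acts on the middle factor is
    [\sum_(c) c1 (a ▷ b) c2 = (a ▷ b) ▷ c].  In those in which [a] acts on [c1]
    or [c2], the coproduct has been applied to a leg of [Delta c]; by
    coassociativity they are [\sum_(c) c1 a c2 b c3] and
    [\sum_(c) c1 b c2 a c3].  The two weight terms are [lambda (ab ▷ c)] and
    [lambda (ba ▷ c)].  So the associator [(a ▷ b) ▷ c - a ▷ (b ▷ c)] is the
    opposite of an expression visibly symmetric in [a] and [b], which is the
    left pre-Lie identity. *)

(** * Linear maps and tensors *)

Section Linear.
Variables (k : comPzRingType) (U V : lmodType k) (f : U -> V).
Hypothesis f_lin : linear f.

Let F : {linear U -> V} := HB.pack f (GRing.isLinear.Build k U V _ f f_lin).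

Lemma linear_morphD : {morph f : x y / x + y}.
Proof. exact: (linearD F). Qed.

Lemma linear_morphZ a : {morph f : x / a *: x}.
Proof. exact: (linearZ_LR F). Qed.

Lemma linear_morph_sum I (r : seq I) (E : I -> U) :
  f (\sum_(i <- r) E i) = \sum_(i <- r) f (E i).
Proof. exact: (linear_sum F). Qed.

End Linear.

Lemma linear_comp (k : comPzRingType) (U V W : lmodType k)
    (f : V -> W) (g : U -> V) : linear f -> linear g -> linear (f \o g).
Proof. by move=> fl gl a x y; rewrite /= gl fl. Qed.

Section LinearOnTensor.
Variables (k : comPzRingType) (M N P : lmodType k).

(** [tensor_lift] sums over a chosen representative, so the right-hand side is
    the same choice of summands for every [f]: this is what lets several
    Sweedler sums over one tensor be split and merged termwise. *)
Lemma linear_tensorE (f : tensor M N -> P) (u : tensor M N) :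
  linear f -> f u = tensor_lift (fun x y => f (x ⊗ y)) u.
Proof. by move=> fl; rewrite {1}(tensor_sumE u) linear_morph_sum. Qed.

Lemma eq_linear_tensor (f g : tensor M N -> P) :
  linear f -> linear g -> (forall x y, f (x ⊗ y) = g (x ⊗ y)) -> f =1 g.
Proof.
move=> fl gl fg u; rewrite (linear_tensorE u fl) (linear_tensorE u gl).
by apply: eq_bigr => p _; apply: fg.
Qed.

End LinearOnTensor.

Lemma tensor_assoc_linear (k : comPzRingType) (M N P : lmodType k) :
  linear (@tensor_assoc k M N P).
Proof. exact: tensor_lift_linear (tensor_assoc_bilinear M N P). Qed.

Lemma tensor_map_linear (k : comPzRingType) (M M' N N' : lmodType k)
    (f : M -> M') (g : N -> N') : linear f -> linear g ->
  linear (tensor_map f g).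
Proof. by move=> fl gl; apply/tensor_lift_linear/tensor_map_bilinear. Qed.

(** * Insertion of elements between tensor legs *)

Section Insertion.
Variables (k : comPzRingType) (A : lmodType k) (m : A -> A -> A).
Hypotheses (m_bilin : bilinear_map m) (mA : associative m).

Let mr x : linear (m x). Proof. by case: m_bilin. Qed.
Let ml y : linear (m^~ y). Proof. by case: m_bilin. Qed.
Let idL : linear (@id A). Proof. by []. Qed.
Let mDl y := linear_morphD (ml y).

Definition insert1 (a : A) : tensor A A -> A :=
  tensor_lift (fun x y => m (m x a) y).

Lemma insert1_bilinear a : bilinear_map (fun x y => m (m x a) y).
Proof. by split=> [x|y]; [apply: mr | apply: linear_comp (ml y) (ml a)]. Qed.

Lemma insert1_linear a : linear (insert1 a).
Proof. exact: tensor_lift_linear (insert1_bilinear a). Qed.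

Lemma insert1E a x y : insert1 a (x ⊗ y) = m (m x a) y.
Proof. exact: tensor_liftE (insert1_bilinear a) x y. Qed.

Lemma insert1_linear_arg u : linear (insert1^~ u).
Proof.
move=> r a b; rewrite /insert1 /tensor_lift scaler_sumr -big_split /=.
apply: eq_bigr => p _; rewrite (mr p.1) mDl.
by rewrite (linear_morphZ (ml p.2)).
Qed.

Lemma insert1_lact a x u : insert1 a (tensor_lact m x u) = m x (insert1 a u).
Proof.
move: u; apply: eq_linear_tensor => [||y z].
- have lactL : linear (tensor_lact m x) := tensor_map_linear (mr x) idL.
  exact: linear_comp (insert1_linear a) lactL.
- exact: linear_comp (mr x) (insert1_linear a).
- by rewrite tensor_lactE // !insert1E !mA.
Qed.

Lemma insert1_ract a u y : insert1 a (tensor_ract m u y) = m (insert1 a u) y.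
Proof.
move: u; apply: eq_linear_tensor => [||x z].
- have ractL : linear ((tensor_ract m)^~ y) := tensor_map_linear idL (ml y).
  exact: linear_comp (insert1_linear a) ractL.
- exact: linear_comp (ml y) (insert1_linear a).
- by rewrite tensor_ractE // !insert1E !mA.
Qed.

Definition insert2 (a b : A) : tensor A (tensor A A) -> A :=
  tensor_lift (fun x v => m (m x a) (insert1 b v)).

Lemma insert2_bilinear a b :
  bilinear_map (fun x v => m (m x a) (insert1 b v)).
Proof.
split=> [x|v].
- exact: linear_comp (mr _) (insert1_linear b).
- exact: linear_comp (ml _) (ml a).
Qed.

Lemma insert2_linear a b : linear (insert2 a b).
Proof. exact: tensor_lift_linear (insert2_bilinear a b). Qed.

Lemma insert2E a b x v : insert2 a b (x ⊗ v) = m (m x a) (insert1 b v).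
Proof. exact: tensor_liftE (insert2_bilinear a b) x v. Qed.

Lemma insert2_assoc a b u z :
  insert2 a b (tensor_assoc (u ⊗ z)) = m (m (insert1 a u) b) z.
Proof.
have tl := (tens_bilinear (tensor A A) A).2.
move: u; apply: eq_linear_tensor => [||x y].
- exact: linear_comp (insert2_linear a b)
                     (linear_comp (@tensor_assoc_linear _ _ _ _) (tl z)).
- exact: linear_comp (ml z) (linear_comp (ml b) (insert1_linear a)).
- by rewrite tensor_assocE insert2E !insert1E !mA.
Qed.

End Insertion.

(** * The product of an infinitesimal bialgebra *)

Section PreLie.
Variables (k : comPzRingType) (lambda : k) (A : lmodType k).
Variables (m : A -> A -> A) (Delta : A -> tensor A A).
Hypothesis HA : infinitesimal_bialgebra lambda m Delta.

Let mB := infbialg_mul_bilinear HA.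
Let mA := infbialg_mulA HA.
Let DeltaL := infbialg_comul_linear HA.
Let idL : linear (@id A). Proof. by []. Qed.
Let ml y : linear (m^~ y). Proof. by case: mB. Qed.

Local Notation "a ▷ b" := (infbialg_rhd m Delta a b) (at level 40).

Lemma infbialg_rhd_bilinear : bilinear_map (infbialg_rhd m Delta).
Proof.
split=> [a|b]; last exact: insert1_linear_arg mB (Delta b).
exact: linear_comp (insert1_linear mB a) DeltaL.
Qed.

Lemma infbialg_rhd_sumE a b :
  a ▷ b = \sum_(p <- tensor_repr (Delta b)) m (m p.1 a) p.2.
Proof. by []. Qed.

Lemma infbialg_rhdM a x y :
  a ▷ m x y = m x (a ▷ y) + m (a ▷ x) y + lambda *: m (m x a) y.
Proof.
have KL := insert1_linear mB a.
rewrite /infbialg_rhd (infbialg_comulM HA) -!/(insert1 m a _).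
rewrite !(linear_morphD KL) (linear_morphZ KL).
by rewrite insert1_lact // insert1_ract // insert1E.
Qed.

(** [insert2 m a b] of the iterated coproduct of [c] is [\sum_(c) c1 a c2 b c3].
    This lemma and the next read it off the two bracketings of that coproduct:
    on the right leg it is a term of [b ▷ (a ▷ c)], on the left leg a term of
    [a ▷ (b ▷ c)]. *)
Lemma insert2_comul_r a b c :
  insert2 m a b (tensor_map id Delta (Delta c)) =
  tensor_lift (fun x y => m (m x a) (b ▷ y)) (Delta c).
Proof.
have TL := linear_comp (insert2_linear mB a b) (tensor_map_linear idL DeltaL).
rewrite [LHS](linear_tensorE _ TL); apply: eq_bigr => p _ /=.
by rewrite tensor_mapE // insert2E.
Qed.

(** Coassociativity moves the second coproduct to the left leg. *)
Lemma insert2_comul_l a b c :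
  insert2 m a b (tensor_map id Delta (Delta c)) =
  tensor_lift (fun x y => m (m (a ▷ x) b) y) (Delta c).
Proof.
have TL := linear_comp (insert2_linear mB a b)
  (linear_comp (@tensor_assoc_linear _ _ _ _) (tensor_map_linear DeltaL idL)).
rewrite -(infbialg_coassoc HA) [LHS](linear_tensorE _ TL).
by apply: eq_bigr => p _ /=; rewrite tensor_mapE // insert2_assoc.
Qed.

(** The summand in parentheses is symmetric in [a] and [b], and it is the
    opposite of the associator of [a], [b], [c]. *)
Lemma infbialg_rhd_rhd a b c :
  let c123 := tensor_map id Delta (Delta c) in
  a ▷ (b ▷ c) = (a ▷ b) ▷ c + (insert2 m a b c123 + insert2 m b a c123
                               + lambda *: (m a b ▷ c + m b a ▷ c)).
Proof.
move=> c123; rewrite /c123 insert2_comul_l insert2_comul_r.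
have aL := infbialg_rhd_bilinear.1 a.
(* every term becomes a sum over the same representative of Delta c *)
rewrite !(infbialg_rhd_sumE _ c) (linear_morph_sum aL) /tensor_lift.
rewrite -!big_split scaler_sumr -!big_split /=; apply: eq_bigr => -[x y] _ /=.
rewrite !infbialg_rhdM !(linear_morphD (ml y)) (linear_morphZ (ml y)).
by rewrite scalerDr !mA -!addrA addrCA; congr (_ + _); rewrite addrCA.
Qed.

End PreLie.

Theorem theorem5p3 (k : comPzRingType) (lambda : k) (A : lmodType k)
    (m : A -> A -> A) (Delta : A -> tensor A A)
    (HA : infinitesimal_bialgebra lambda m Delta) :
  left_pre_lie (infbialg_rhd m Delta).
Proof.
split=> [|a b c]; first exact: infbialg_rhd_bilinear HA.
rewrite (infbialg_rhd_rhd HA a b) (infbialg_rhd_rhd HA b a).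
rewrite [in LHS]opprD [in RHS]opprD !addNKr.
by congr (- (_ + _)); rewrite addrC.
Qed.
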